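(* Under the fixed-budget attack model, let $h_{t,\min}=\min_kh_t(k)$ and let $\tau_t$ be the risk budget of slot $t$. If $\tau_t\ge h_{t,\min}$ and the executed policy is the Safe policy $\mathbf p_t=\boldsymbol\pi_t^{\mathrm{safe}}$, then \[ \Pr(A_t\in\mathcal J_t\mid\mathcal P_t)=\langle\boldsymbol\pi_t^{\mathrm{safe}},\mathbf h_t\rangle\le\tau_t . \] If $\tau_t<h_{t,\min}$, then every policy $\mathbf p\in\Delta_K$ violates the budget by at least $h_{t,\min}-\tau_t$, i.e. $\langle\mathbf p,\mathbf h_t\rangle-\tau_t\ge h_{t,\min}-\tau_t$, and a distribution supported on the minimum-risk channels $\{k:h_t(k)=h_{t,\min}\}$ attains this smallest possible violation.
   Context: There are $K$ channels $[K]$; $\Delta_K$ is the probability simplex in $\mathbb R^K$; the attack budget is $M\in\{0,\dots,K-1\}$. Fixed-budget attack model: in slot $t$ a vector $\mathbf h_t\in[0,1]^K$ with $\sum_kh_t(k)=M$ is publicly known, and the adversary commits a hidden random set $\mathcal J_t\subseteq[K]$ with $|\mathcal J_t|=M$ before the learner forms its policy $\mathbf p_t\in\Delta_K$ and privately samples $A_t\sim\mathbf p_t$. $\mathcal P_t$ is the public information available after $\mathbf p_t$ is formed and before $A_t$ is sampled (it determines $\mathbf h_t,\tau_t,\mathbf p_t$ but excludes $\mathcal J_t$ and $A_t$). The model satisfies $\Pr(k\in\mathcal J_t\mid\mathcal P_t)=h_t(k)$ for all $k$, $\Pr(A_t=k\mid\mathcal P_t)=p_t(k)$, and $A_t$ and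 $\mathcal J_t$ are conditionally independent given $\mathcal P_t$. The Safe policy is the KL projection of a strictly positive pre-projection policy $\overline{\boldsymbol\pi}_t\in\Delta_K$ onto the risk-feasible simplex: \[ \boldsymbol\pi_t^{\mathrm{safe}}=\arg\min\{D_{\mathrm{KL}}(\boldsymbol\pi\Vert\overline{\boldsymbol\pi}_t):\boldsymbol\pi\in\Delta_K,\ \langle\boldsymbol\pi,\mathbf h_t\rangle\le\tau_t\}, \] which is feasible exactly when $\tau_t\ge h_{t,\min}$. *)

(* Defs.v *)
From HB Require Import structures.
From mathcomp Require Export all_boot all_order all_algebra.
From mathcomp Require Export all_classical all_reals all_analysis.
Set Implicit Arguments.
Unset Strict Implicit.
Unset Printing Implicit Defensive.
Export Order.TTheory GRing.Theory Num.Theory.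
Export numFieldNormedType.Exports.
#[export] Set Implicit Arguments.
#[export] Unset Strict Implicit.
#[export] Unset Printing Implicit Defensive.
Local Open Scope classical_set_scope.
Local Open Scope ring_scope.

Section ConditionalProbability.
Context {d : measure_display} {Omega : measurableType d} {R : realType}.
Implicit Types (P : probability Omega R) (F : set (set Omega)).
Implicit Types (E : set Omega) (f g : Omega -> R).

Definition sub_sigma_algebra_of_events F : Prop :=
  sigma_algebra setT F /\ F `<=` measurable.

Definition measurable_wrt F f : Prop :=
  forall B : set R, measurable B -> F (f @^-1` B).

(* [g] is a version of Pr(E | F). *)
Definition is_cond_prob P F E g : Prop :=
  [/\ measurable_wrt F g,
      P.-integrable setT (fun w => (g w)%:E) &
      forall B, F B -> (\int[P]_(w in B) (g w)%:E)%E = P (E `&` B)].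

(* Pr(X \in B, Y \in C | F) = Pr(X \in B | F) Pr(Y \in C | F) almost surely;
   every subset of a finite type counts as measurable. *)
Definition cond_independent P F (T1 T2 : finType)
    (X : Omega -> T1) (Y : Omega -> T2) : Prop :=
  forall (B : {set T1}) (C : {set T2}) g1 g2,
    is_cond_prob P F [set w | X w \in B] g1 ->
    is_cond_prob P F [set w | Y w \in C] g2 ->
    is_cond_prob P F [set w | (X w \in B) && (Y w \in C)]
      (fun w => g1 w * g2 w).

End ConditionalProbability.

Section Policies.
Context {R : realType} {K : nat}.
Implicit Types (p q h pi pibar : 'rV[R]_K).

Definition simplex : set 'rV[R]_K :=
  [set p | (forall k, 0 <= p 0 k) /\ \sum_k p 0 k = 1].

Definition dot p h : R := \sum_k p 0 k * h 0 k.

(* For 0 < K the infimum is over a finite nonempty set, hence a minimum. *)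
Definition min_risk h : R := inf [set h 0 k | k in [set: 'I_K]].

(* Real-valued, so only meaningful for a strictly positive second argument;
   the convention 0 ln 0 = 0 holds because [ln 0 = 0]. *)
Definition kl_div p q : R := \sum_k p 0 k * ln (p 0 k / q 0 k).

Definition risk_feasible h (tau : R) : set 'rV[R]_K :=
  [set p | simplex p /\ dot p h <= tau].

Definition kl_projections (A : set 'rV[R]_K) q : set 'rV[R]_K :=
  [set p | A p /\ forall p', A p' -> kl_div p q <= kl_div p' q].

(* The arg min (unique by strict convexity); the default value 0, which is not
   a policy, is returned only when there is no minimiser. *)
Definition safe_policy pibar h (tau : R) : 'rV[R]_K :=
  xget 0 (kl_projections (risk_feasible h tau) pibar).

End Policies.

(* One slot of the fixed-budget attack model. The sigma-algebra [F] is the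
   public information available between the formation of the policy [p] and
   the sampling of the channel [A]; [J] is the hidden attacked set. *)
Record fixed_budget_slot (R : realType) (d : measure_display)
    (Omega : measurableType d) (P : probability Omega R) (K M : nat)
    (F : set (set Omega)) (h : Omega -> 'rV[R]_K) (tau : Omega -> R)
    (p : Omega -> 'rV[R]_K) (A : Omega -> 'I_K) (J : Omega -> {set 'I_K})
    : Prop := FixedBudgetSlot {
  slot_info : sub_sigma_algebra_of_events F;
  slot_h_info : forall k, measurable_wrt F (fun w => h w 0 k);
  slot_tau_info : measurable_wrt F tau;
  slot_p_info : forall k, measurable_wrt F (fun w => p w 0 k);
  slot_A_meas : forall k, measurable [set w | A w = k];
  slot_J_meas : forall S, measurable [set w | J w = S];
  slot_h_range : forall w k, 0 <= h w 0 k <= 1;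
  slot_h_sum : forall w, \sum_k h w 0 k = M%:R;
  slot_J_card : forall w, #|J w| = M;
  slot_p_simplex : forall w, simplex (p w);
  slot_J_law : forall k,
    is_cond_prob P F [set w | k \in J w] (fun w => h w 0 k);
  slot_A_law : forall k,
    is_cond_prob P F [set w | A w = k] (fun w => p w 0 k);
  slot_indep : cond_independent P F A J
}.

(* Main.v *)
Require Import Defs.
Local Open Scope classical_set_scope.
Local Open Scope ring_scope.

(** The attack event splits according to the sampled channel, and conditional independence gives the
    piece for channel [k] the conditional probability [p k * h k]; summing, [dot p h] is a version
    of Pr(A in J | F) ([attack_cond_prob]). Any two versions agree almost surely
    ([is_cond_prob_unique]). Where [p] is the Safe policy, its membership in the simplex certifies a
    genuine projection, hence a point within budget ([safe_policy_feasible]). The infeasible case is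
    about weighted averages: [dot q h] is at least the smallest risk ([min_risk_le_dot]), with
    equality when the weights sit on minimisers ([dot_min_risk]). *)

(** A sigma-algebra generates itself. This bridge makes closure of measurable functions under sums
    and comparisons available relative to [F]. *)
Lemma measurable_wrtE d (Omega : measurableType d) (R : realType)
    (F : set (set Omega)) (f : Omega -> R) :
  sigma_algebra setT F ->
  measurable_wrt F f <->
  measurable_fun setT (f : g_sigma_algebraType F -> R).
Proof.
move=> sF; split=> [mf _ B mB|mf B mB].
- by rewrite setTI; apply: sub_sigma_algebra; exact: mf.
- by have := mf measurableT B mB; rewrite setTI /measurable/= sigma_algebra_id.
Qed.

Lemma is_cond_prob_bigsetU d (Omega : measurableType d) (R : realType)
    (P : probability Omega R) (F : set (set Omega)) n
    (E : 'I_n -> set Omega) (g : 'I_n -> Omega -> R) :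
  sub_sigma_algebra_of_events F ->
  (forall k, measurable (E k)) -> trivIset setT E ->
  (forall k, is_cond_prob P F (E k) (g k)) ->
  is_cond_prob P F (\big[setU/set0]_(k < n) E k) (fun w => \sum_k g k w).
Proof.
move=> [sF FM] mE tE gE.
have ig k : P.-integrable setT (fun w => (g k w)%:E) by have [] := gE k.
split.
- apply/(measurable_wrtE _ sF)/measurable_sum => k.
  by apply/measurable_wrtE => //; have [] := gE k.
- under eq_fun do rewrite -sumEFin.
  exact: integrable_sum.
- move=> B FB; have mB := FM _ FB.
  under eq_integral do rewrite -sumEFin.
  rewrite integral_sum//; last first.
    by move=> k; apply: integrableS (ig k).
  rewrite big_distrl/= measure_bigsetU_ord; last 2 first.
  + by move=> k; exact: measurableI.
  + exact: trivIset_setIr.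
  by apply: eq_bigr => k _; have [_ _ ->] := gE k.
Qed.

(** The set where one version is strictly below the other lies in [F], so both versions have the
    same integral over it, which forces it to be negligible. Exchanging the versions covers the
    other inequality. *)
Lemma is_cond_prob_unique d (Omega : measurableType d) (R : realType)
    (P : probability Omega R) (F : set (set Omega)) (E : set Omega)
    (f g : Omega -> R) :
  sub_sigma_algebra_of_events F ->
  is_cond_prob P F E f -> is_cond_prob P F E g ->
  {ae P, forall w, f w = g w}.
Proof.
move=> [sF FM].
have half (u v : Omega -> R) : is_cond_prob P F E u ->
    is_cond_prob P F E v -> P.-negligible [set w | u w < v w].
  move=> [mu iu intu] [mv iv intv]; set B := [set w | u w < v w].
  have FB : F B.
    move/(measurable_wrtE _ sF) : mu => mu.
    move/(measurable_wrtE _ sF) : mv => mv.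
    have := measurable_realfun.measurable_fun_ltr mu mv measurableT.
    by move=> /(_ [set true] I); rewrite setTI /measurable/= sigma_algebra_id.
  have mB := FM _ FB.
  have iuB := integrableS measurableT mB (@subsetT _ _) iu.
  have ivB := integrableS measurableT mB (@subsetT _ _) iv.
  have iB := integrableB mB ivB iuB.
  have : (\int[P]_(w in B) `|(v w)%:E - (u w)%:E|)%E = 0%E.
    rewrite -[RHS](_ : (\int[P]_(w in B) (v w)%:E -
        \int[P]_(w in B) (u w)%:E)%E = _); last first.
      (* Both integrals equal P(E [&] B); integrability makes this value finite, so the difference
         is 0. *)
      by rewrite intu// intv// subee// -intu// integrable_fin_num.
    rewrite -integralB//; apply: eq_integral => w; rewrite inE/= => uv.
    by rewrite -EFinB /= gtr0_norm// subr_gt0.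
  (* The difference vanishes almost everywhere on [B] but is positive at every point of [B], so [B]
     itself is negligible. *)
  move=> /(ae_eq_integral_abs _ mB (measurable_int _ iB)).
  apply: negligibleS => w /= uv /(_ uv)/eqP.
  by rewrite -EFinB eqe subr_eq0 gt_eqF.
move=> fE gE.
have := negligibleU (half _ _ fE gE) (half _ _ gE fE).
apply: negligibleS => w /= /eqP.
by rewrite neq_lt => /orP[]; [left|right].
Qed.

Section Policies.
Context {R : realType} {K : nat}.
Implicit Types (p q h : 'rV[R]_K).

Lemma min_risk_le h k : min_risk h <= h 0 k.
Proof.
apply: ge_inf; last by exists k.
(* An explicit lower bound for all entries, since [ge_inf] asks for a bounded set. *)
exists (- \sum_i `|h 0 i|) => _ [i _ <-].
rewrite lerNl (le_trans (ler_norm _))// normrN (bigD1 i)//= lerDl.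
exact: sumr_ge0.
Qed.

Lemma min_risk_attained h : (0 < K)%N -> exists k, h 0 k = min_risk h.
Proof.
move=> K0; pose i0 := Ordinal K0.
have [i _ hi] := @arg_minP _ _ _ i0 xpredT (fun k => h 0 k) isT.
exists i; apply/eqP; rewrite eq_le min_risk_le andbT.
apply: lb_le_inf; first by exists (h 0 i), i.
by move=> _ [k _ <-]; exact: hi.
Qed.

Lemma min_risk_le_dot q h : simplex q -> min_risk h <= dot q h.
Proof.
move=> [q0 q1]; rewrite -[leLHS]mul1r -q1 mulr_suml.
by apply: ler_sum => k _; rewrite ler_wpM2l// min_risk_le.
Qed.

Lemma dot_min_risk q h : simplex q ->
  (forall k, q 0 k != 0 -> h 0 k = min_risk h) -> dot q h = min_risk h.
Proof.
move=> [_ q1] qh; rewrite -[RHS]mul1r -q1 mulr_suml.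
by apply: eq_bigr => k _; have [->|/qh->//] := eqVneq (q 0 k) 0; rewrite !mul0r.
Qed.

Lemma simplex_delta k : simplex (delta_mx 0 k : 'rV[R]_K).
Proof.
split=> [i|]; first by rewrite mxE ler0n.
rewrite (bigD1 k)//= mxE !eqxx big1 ?addr0// => i ik.
by rewrite mxE (negbTE ik) andbF.
Qed.

(* The default value 0 of [safe_policy] is not in the simplex, so no existence
   theorem for the KL projection is needed. *)
Lemma safe_policy_feasible pibar h (tau : R) :
  simplex (safe_policy pibar h tau) -> dot (safe_policy pibar h tau) h <= tau.
Proof.
rewrite /safe_policy; case: xgetP => [p _ [[]]//|_ [_]].
by under eq_bigr do rewrite mxE; rewrite big1// => /esym/eqP; rewrite oner_eq0.
Qed.

End Policies.

(* {A \in J} is the disjoint union over k of {A = k, k \in J}, and conditional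
   independence factors the conditional probability of each piece. *)
Lemma attack_cond_prob (R : realType) d (Omega : measurableType d)
    (P : probability Omega R) (K M : nat) (F : set (set Omega))
    (h : Omega -> 'rV[R]_K) (tau : Omega -> R) (p : Omega -> 'rV[R]_K)
    (A : Omega -> 'I_K) (J : Omega -> {set 'I_K}) :
  fixed_budget_slot P M F h tau p A J ->
  is_cond_prob P F [set w | A w \in J w] (fun w => dot (p w) (h w)).
Proof.
move=> [sF _ _ _ mA mJ _ _ _ _ lawJ lawA indep].
(* Membership in finite sets is the form in which [cond_independent] takes events of [A] and [J]. *)
pose E k := [set w | (A w \in [set k]%SET) &&
    (J w \in [set S : {set 'I_K} | k \in S]%SET)].
have -> : [set w | A w \in J w] = \big[setU/set0]_(k < K) E k.
  rewrite -(bigcup_pred xpredT); apply/seteqP; split => [w AJ|w [k _]] /=.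
  - by exists (A w) => //=; rewrite /E /= !inE eqxx.
  - by rewrite /E /= !inE => /andP[/eqP ->].
apply: is_cond_prob_bigsetU => //.
(* [J] has finitely many values, so the event that [k] is attacked is a finite union of level sets
   of [J]. *)
- move=> k; have -> : E k = [set w | A w = k] `&`
      \bigcup_(S in [set S : {set 'I_K} | k \in S]) [set w | J w = S].
    apply/seteqP; split => [w|w [/= Ak [S /= kS JS]]]; rewrite /E /= !inE.
    + by move=> /andP[/eqP Ak kJ]; split => //; exists (J w).
    + by rewrite Ak eqxx JS.
  by apply: measurableI => //; apply: fin_bigcup_measurable => //;
    exact: finite_finset.
- move=> i j _ _ [w []]; rewrite /E /= !inE.
  by move=> /andP[/eqP <- _] /andP[/eqP <-].
- move=> k; apply: indep.
  + have := lawA k; congr is_cond_prob.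
    by apply/seteqP; split => w /=; rewrite inE => /eqP.
  + have := lawJ k; congr is_cond_prob.
    by apply/seteqP; split => w /=; rewrite inE.
Qed.

Theorem theorem5 (R : realType) (d : measure_display)
    (Omega : measurableType d) (P : probability Omega R) (K M : nat)
    (ltMK : (M < K)%N)
    (F : set (set Omega)) (h : Omega -> 'rV[R]_K) (tau : Omega -> R)
    (pibar p : Omega -> 'rV[R]_K) (A : Omega -> 'I_K)
    (J : Omega -> {set 'I_K})
    (model : fixed_budget_slot P M F h tau p A J)
    (pibar_simplex : forall w, simplex (pibar w))
    (pibar_gt0 : forall w k, 0 < pibar w 0 k) :
  let safe := fun w => safe_policy (pibar w) (h w) (tau w) in
  [/\ exists g, is_cond_prob P F [set w | A w \in J w] g,
      forall g, is_cond_prob P F [set w | A w \in J w] g ->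
        {ae P, forall w, min_risk (h w) <= tau w -> p w = safe w ->
          g w = dot (safe w) (h w) /\ dot (safe w) (h w) <= tau w} &
      forall w, tau w < min_risk (h w) ->
        [/\ forall q : 'rV[R]_K, simplex q ->
              min_risk (h w) - tau w <= dot q (h w) - tau w,
            exists q : 'rV[R]_K, simplex q /\
              (forall k, q 0 k != 0 -> h w 0 k = min_risk (h w)) &
            forall q : 'rV[R]_K, simplex q ->
              (forall k, q 0 k != 0 -> h w 0 k = min_risk (h w)) ->
              dot q (h w) - tau w = min_risk (h w) - tau w]].

Proof.
move=> safe; have pE := attack_cond_prob model.
split.
- by exists (fun w => dot (p w) (h w)).
- move=> g gE; have := is_cond_prob_unique (slot_info model) gE pE.
  apply: filterS => w gw _ psafe; rewrite gw -psafe; split => //.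
  (* The executed policy lies in the simplex by the model, hence so does the Safe policy it
     equals. *)
  rewrite psafe; apply: safe_policy_feasible; rewrite -/(safe w) -psafe.
  exact: (slot_p_simplex model).
- move=> w _; split => [q sq||q sq qh].
  + by rewrite lerD2r min_risk_le_dot.
  + have [k hk] := min_risk_attained (h w) (leq_ltn_trans (leq0n M) ltMK).
    (* The point mass at a minimum-risk channel; one exists because [M < K] makes [K] positive. *)
    exists (delta_mx 0 k); split => [|i]; first exact: simplex_delta.
    by rewrite mxE eqxx/=; case: (eqVneq i k) => [->|_]; rewrite ?eqxx.
  + by rewrite dot_min_risk.
Qed.
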